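(* Let $\mathbf G$ be a compact metric graph with $\mathbf V_{end}\neq\emptyset$, and let $a_*\in M$. Then $$S_\infty(\mathbf G)=\frac1{G(a_*,a_* )}.$$ Moreover, the function $$w_{a_*}(x)=\frac{G(x,a_* )}{G(a_*,a_* )},\qquad x\in\mathbf G,$$ is a minimizer of $S_\infty(\mathbf G)$. Conversely, every nonnegative minimizer of $S_\infty(\mathbf G)$ is of the form $w_{a^*}$ for some $a^*\in M$.
   Context: Graphs. $\mathbf G=\mathbf G(\mathbf V,\mathbf E)$ is a graph with vertex set $\mathbf V$ and edge set $\mathbf E$; it is connected, has finitely many edges, contains no loops, and no vertex has degree $2$. It is a compact metric graph: each edge $\mathbf e$ is identified with an interval $[0,l(\mathbf e)]$ with $0<l(\mathbf e)<\infty$. $\mathbf V_{end}$ is the set of vertices of degree $1$; all other vertices have degree $\ge3$. Function spaces. $u^{(\mathbf e)}$ is the restriction of $u$ to $\mathbf e$, $\nabla=\frac{d}{dx}$ on each edge, $\int_{\mathbf G}=\sum_{\mathbf e}\int_0^{l(\mathbf e)}$. $H^1(\mathbf G)$ is the space of continuous $u$ on $\mathbf G$ with $u^{(\mathbf e)}\in H^1(\mathbf e)$ for all $\mathbf e$, with $\|u\|_{H^1(\mathbf G)}^2=\int_{\mathbf G}(|\nabla u|^2+u^2)dx$; $H^1_0(\mathbf G)=\{u\in H^1(\mathbf G):u(\mathbf v)=0\ \forall\mathbf v\in\mathbf V_{end}\}$. Green function. For $y\in\mathbf G\setminus\mathbf V_{end}$, $G(\cdot,y)$ is the unique element of $H_0^1(\mathbf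 G)$ with $\int_{\mathbf G}\nabla_xG(x,y)\nabla\varphi(x)\,dx=\varphi(y)$ for all $\varphi\in H^1_0(\mathbf G)$; for $y\in\mathbf V_{end}$, $G(\cdot,y)=0$. $M=\{a\in\mathbf G:G(a,a)=\max_{x\in\mathbf G}G(x,x)\}$. Limiting constant. $S_\infty(\mathbf G)=\inf\{\int_{\mathbf G}|\nabla u|^2dx:\ u\in H^1_0(\mathbf G),\ \|u\|_{L^\infty(\mathbf G)}=1\}$. A minimizer of $S_\infty(\mathbf G)$ is an admissible function attaining this infimum. *)

(* Defs.v *)
From HB Require Import structures.
From mathcomp Require Import all_boot all_order all_algebra.
From mathcomp Require Import all_classical all_reals all_analysis.
Set Implicit Arguments.
Unset Strict Implicit.
Unset Printing Implicit Defensive.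
Import Order.TTheory GRing.Theory Num.Theory.
Import numFieldNormedType.Exports.

Local Open Scope classical_set_scope.
Local Open Scope ring_scope.

Local Notation mu := lebesgue_measure.

(* For loopless graphs, the degree of v is the cardinality of this set. *)
Definition incident_edges (V E : finType) (src tgt : E -> V) (v : V) : {set E} :=
  [set e | (src e == v) || (tgt e == v)]%SET.

(* Parallel edges are allowed, loops are not.  Each edge carries an arbitrary
   orientation, used only to identify it with [0, len e]. *)
Record metric_graph (R : realType) := MetricGraph {
  vertex : finType;
  edge : finType;
  src : edge -> vertex;
  tgt : edge -> vertex;
  len : edge -> R;
  len_gt0 : forall e, 0 < len e;
  no_loop : forall e, src e != tgt e;
  graph_connected : forall v w,
    connect [rel x y | [exists e,
      ((src e == x) && (tgt e == y)) || ((src e == y) && (tgt e == x))]] v w;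
  degree_neq2 : forall v, #|incident_edges src tgt v| != 2
}.

Section graph.
Context {R : realType} (g : metric_graph R).
Implicit Types (v : vertex g) (e : edge g).

Definition Vend : {set vertex g} :=
  [set v | #|incident_edges (@src R g) (@tgt R g) v| == 1]%SET.

(* The points of G: the disjoint union of the intervals [0, len e] modulo the
   identification of endpoints, given by its canonical representatives. *)
Inductive gpoint :=
  | Vertex of vertex g
  | Inner e of {t : R | 0 < t < len e}.

HB.instance Definition _ := gen_eqMixin gpoint.
HB.instance Definition _ := gen_choiceMixin gpoint.

(* The quotient map [0, len e] -> G, extended to R by clamping. *)
Definition chart e (t : R) : gpoint :=
  if t <= 0 then Vertex (src e) else
  if insub t is Some s then Inner (e := e) s else Vertex (tgt e).

(* The quotient topology: as clamping retracts R onto [0, len e], it does not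
   matter whether preimages are taken in R or in [0, len e]. *)
Definition point_open (A : set gpoint) := forall e, open (chart e @^-1` A).

Fact point_openT : point_open setT.
Proof. by move=> e; rewrite preimage_setT; exact: openT. Qed.

Fact point_openI : setI_closed point_open.
Proof.
by move=> A B oA oB e; rewrite preimage_setI; apply: openI; [exact: oA|exact: oB].
Qed.

Fact point_open_bigU (I : Type) (f : I -> set gpoint) :
  (forall i, point_open (f i)) -> point_open (\bigcup_i f i).
Proof.
by move=> fo e; rewrite preimage_bigcup; apply: bigcup_open => i _; exact: fo.
Qed.

HB.instance Definition _ :=
  isOpenTopological.Build gpoint point_openT point_openI point_open_bigU.

Implicit Types (u : gpoint -> R) (h : R -> R).

Definition restr u e : R -> R := u \o chart e.

Definition edge_itv e : set R := `[0, len e].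

Definition edge_L2 e (h : R -> R) := (h \_ (edge_itv e)) \in Lfun (@mu R) 2%:E.

(* The test functions C^1_c(]0, len e[). *)
Definition test_fun e (phi : R -> R) :=
  [/\ forall t, derivable phi t 1, continuous (derive1 phi) &
      exists a b, [/\ 0 < a, b < len e &
        forall t, t \notin `[a, b] -> phi t = 0]].

Definition weak_deriv e (h dh : R -> R) := forall phi, test_fun e phi ->
  \int[mu]_(t in edge_itv e) (h t * derive1 phi t) =
  - \int[mu]_(t in edge_itv e) (dh t * phi t).

Definition edge_H1 e h :=
  edge_L2 e h /\ exists dh, edge_L2 e dh /\ weak_deriv e h dh.

Definition H1 u := continuous u /\ forall e, edge_H1 e (restr u e).

Definition H10 u := H1 u /\ forall v, v \in Vend -> u (Vertex v) = 0.

(* A representative of the weak derivative, which is only determined almost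
   everywhere; junk (0) unless the restriction of u to e is in H^1(e). *)
Definition nabla u e : R -> R :=
  xget (cst 0) [set dh | edge_L2 e dh /\ weak_deriv e (restr u e) dh].

Definition int_graph (f : edge g -> R -> R) : R :=
  \sum_e \int[mu]_(t in edge_itv e) f e t.

Definition dirichlet u w : R :=
  int_graph (fun e t => nabla u e t * nabla w e t).

Definition energy u : R := int_graph (fun e t => `|nabla u e t| ^+ 2).

Definition norm_Linfty u : \bar R :=
  \big[Order.max/0%E]_e
    ('N[@mu R]_+oo [EFin \o (restr u e \_ (edge_itv e))])%E.

(* Gr x y stands for G(x, y). *)
Definition is_green (Gr : gpoint -> gpoint -> R) :=
  forall y,
    ((exists2 v, v \in Vend & y = Vertex v) -> forall x, Gr x y = 0) /\
    (~ (exists2 v, v \in Vend & y = Vertex v) ->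
       H10 (Gr^~ y) /\
       forall phi, H10 phi -> dirichlet (Gr^~ y) phi = phi y).

Definition argmax_green (Gr : gpoint -> gpoint -> R) : set gpoint :=
  [set a | forall x, Gr x x <= Gr a a].

Definition admissible u := H10 u /\ norm_Linfty u = 1%E.

Definition S_infty : R := inf [set energy u | u in admissible].

Definition minimizer u := admissible u /\ energy u = S_infty.

Definition green_normalized (Gr : gpoint -> gpoint -> R) (a : gpoint) : gpoint -> R :=
  fun x => Gr x a / Gr a a.

End graph.

(* Main.v *)
Require Import Defs.
From mathcomp Require Import all_boot all_order all_algebra.
From mathcomp Require Import all_classical all_reals all_analysis.
From mathcomp Require Import measurable_realfun ess_sup_inf ring lra.
Import Order.TTheory GRing.Theory Num.Theory.
Import numFieldNormedType.Exports.

(** Write [E] for the energy and [D] for the Dirichlet form.  Everything comes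
    from the reproducing property [D(G(., y), phi) = phi(y)] and the
    Cauchy-Schwarz inequality, which together give ([green_ineq])
      [phi(y)^2 <= G(y, y) * E(phi)]   for all [phi] in [H^1_0] and all [y].

    Lower bound: an admissible [u] is continuous, so it attains the value 1 in
    modulus at some [x] ([norm_Linfty1P]), and then
    [1 <= G(x, x) * E(u) <= G(a, a) * E(u)] for [a] in [M].

    Attainment: applied to [phi = G(., a)], whose energy is [G(a, a)], the
    inequality yields [G(x, a)^2 <= G(x, x) * G(a, a) <= G(a, a)^2], so that [w_a]
    is admissible, with energy [1 / G(a, a)].  Dividing by [G(a, a)] is legitimate
    since a nonzero element of [H^1_0] forces [G(x, x) > 0] somewhere
    ([argmax_green_gt0]).

    Uniqueness: let [u >= 0] be a minimizer with [u(b) = 1].  The lower bound is an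
    equality, hence [b] is in [M], and expanding the square gives
    [E(u - w_b) = E(u) - 2 u(b) / G(b, b) + 1 / G(b, b) = 0].  The inequality
    above, now applied to [u - w_b] at every point, shows that [u = w_b].

    The analytic price is that [D] be a bilinear form although [nabla] is an
    arbitrarily chosen weak derivative.  Weak derivatives are unique almost
    everywhere by the fundamental lemma of the calculus of variations, so [nabla]
    is linear almost everywhere ([nabla_lin]) and the energy of a linear
    combination expands as a quadratic polynomial ([energy_lin]). *)

Set Implicit Arguments.
Unset Strict Implicit.
Unset Printing Implicit Defensive.
Local Open Scope classical_set_scope.
Local Open Scope ring_scope.
Local Notation mu := lebesgue_measure.

(** * Continuously differentiable functions *)

Definition C1 {R : realType} (f : R -> R) :=
  (forall t, derivable f t 1) /\ continuous (derive1 f).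

Section C1_functions.
Context {R : realType}.
Implicit Types f g df : R -> R.

Lemma C1_continuous f : C1 f -> continuous f.
Proof. by move=> [df _] t; apply/differentiable_continuous/derivable1_diffP. Qed.

Lemma C1_is_derive f df :
  (forall t : R, is_derive t 1 f (df t)) -> continuous df -> C1 f.
Proof.
move=> fdf cdf; split=> [t|]; first by case: (fdf t).
suff -> : derive1 f = df by [].
by apply/funext => t; rewrite derive1E; exact: derive_val.
Qed.

Lemma C1_derive f (t : R) : C1 f -> is_derive t 1 f (derive1 f t).
Proof. by move=> [df _]; rewrite derive1E; exact: derivableP. Qed.

Lemma C1M f g : C1 f -> C1 g -> C1 (f * g).
Proof.
move=> f1 g1; apply: (@C1_is_derive _
  (fun t => f t *: derive1 g t + g t *: derive1 f t)).
  by move=> t; apply: is_deriveM; exact: C1_derive.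
move=> t; apply: cvgD; apply: cvgM; (try exact: C1_continuous).
- exact: g1.2.
- exact: f1.2.
Qed.

Lemma C1_comp f g : C1 f -> C1 g -> C1 (f \o g).
Proof.
move=> f1 g1; apply: (@C1_is_derive _ (fun t => derive1 f (g t) * derive1 g t)).
  by move=> t; apply: is_derive1_comp; exact: C1_derive.
move=> t; apply: cvgM; last exact: g1.2.
apply: (@continuous_comp _ _ _ g (derive1 f)); [exact: C1_continuous|exact: f1.2].
Qed.

Lemma C1V f : (forall t, f t != 0) -> C1 f -> C1 (fun t => (f t)^-1).
Proof.
move=> f0 f1; apply: (@C1_is_derive _ (fun t => - (f t) ^- 2 *: derive1 f t)).
  move=> t; apply: DeriveDef; first by apply: derivableV => //; case: f1.
  by rewrite deriveV// -?derive1E//; case: f1.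
move=> t; apply: cvgM; last exact: f1.2.
apply: cvgN; apply: cvgV; first by rewrite expf_neq0.
by apply: cvgM; exact: C1_continuous.
Qed.

Lemma C1_addr c f : C1 f -> C1 (fun t => c + f t).
Proof.
move=> f1; apply: (@C1_is_derive _ (derive1 f)); last exact: f1.2.
move=> t; rewrite -[derive1 f t]add0r.
by apply: is_deriveD; exact: C1_derive.
Qed.

Lemma C1_id : C1 (@id R).
Proof.
by apply: (@C1_is_derive _ (cst 1)) => t; exact: cvg_cst.
Qed.

Lemma C1_opp : C1 (fun t : R => - t).
Proof.
by apply: (@C1_is_derive _ (cst (- 1))) => t; exact: cvg_cst.
Qed.

(** The squared positive part is a one-sided function that is still of class C^1;
    the test functions below are built from its translates and reflections. *)
Lemma C1_sqr_pos_part : C1 (fun t : R => Num.max t 0 ^+ 2).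
Proof.
apply: (@C1_is_derive _ (fun t => 2 * Num.max t 0)); last first.
  move=> t; apply: cvgM; first exact: cvg_cst.
  by apply: continuous_max; [exact: cvg_id|exact: cvg_cst].
move=> t; have [t0|t0|->] := ltgtP t 0.
- apply: (@near_eq_is_derive _ _ _ (cst 0)); last first.
    by rewrite mulr0; exact: is_derive_cst.
  by near=> s; rewrite max_r ?expr0n//; apply/ltW; near: s; exact: lt_nbhsl.
- apply: (@near_eq_is_derive R R R (fun s : R => s ^+ 2)); last first.
    by apply: is_derive_eq; rewrite /GRing.scale/=; ring.
  by near=> s; rewrite max_l//; apply/ltW; near: s; exact: lt_nbhsr.
rewrite mulr0.
(* At 0 the difference quotient is the positive part of h. *)
have cv : (fun h : R =>
    h^-1 *: (Num.max (h *: (1 : R) + 0 : R) 0 ^+ 2 - Num.max 0 0 ^+ 2) : R) @ 0^' --> (0 : R).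
  apply/norm_cvg0P.
  apply: (@squeeze_cvgr _ _ _ _ (cst 0) (fun h : R => `|h|)).
  - near=> h; rewrite normr_ge0/= addr0 maxxx expr0n subr0 /GRing.scale/= mulr1.
    have h0 : h != 0 by near: h; exact: nbhs_dnbhs_neq.
    case: (leP h 0) => h0'; first by rewrite expr0n mulr0 normr0.
    by rewrite expr2 mulrA mulVf// mul1r.
  - exact: cvg_cst.
  - rewrite -[X in _ --> X](@normr0 _ R); apply: cvg_norm; apply: cvg_within_filter.
    exact: cvg_id.
apply: DeriveDef; first by apply/cvg_ex; exists 0; exact: cv.
exact/cvg_lim.
Unshelve. all: by end_near. Qed.

End C1_functions.

(** * Smooth cutoffs and the fundamental lemma of the calculus of variations *)

Section cutoff.
Context {R : realType}.
Implicit Types (s r t : R) (n : nat).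

Definition bump s r t : R := Num.max (t - s) 0 ^+ 2 * Num.max (r - t) 0 ^+ 2.

Lemma bump_ge0 s r t : 0 <= bump s r t.
Proof. by rewrite mulr_ge0// sqr_ge0. Qed.

Lemma bump_gt0 s r t : t \in `]s, r[ -> 0 < bump s r t.
Proof.
rewrite in_itv/= => /andP[st tr].
by rewrite /bump !max_l ?subr_ge0 ?ltW// mulr_gt0// exprn_gt0// subr_gt0.
Qed.

Lemma bump_out s r t : t \notin `]s, r[ -> bump s r t = 0.
Proof.
rewrite in_itv/= negb_and -!leNgt /bump => /orP[|] h.
- by rewrite max_r ?subr_le0// expr0n mul0r.
- by rewrite [X in _ * X ^+ _]max_r ?subr_le0// expr0n mulr0.
Qed.

Lemma C1_bump s r : C1 (bump s r).
Proof.
apply: (@C1M _ (fun t => Num.max (t - s) 0 ^+ 2) (fun t => Num.max (r - t) 0 ^+ 2)).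
- apply: (@C1_comp _ (fun t => Num.max t 0 ^+ 2) (fun t => t - s)).
    exact: C1_sqr_pos_part.
  rewrite (_ : (fun t => t - s) = (fun t => - s + t)); last first.
    by apply/funext => t; rewrite addrC.
  exact: (@C1_addr _ (- s) id C1_id).
- apply: (@C1_comp _ (fun t => Num.max t 0 ^+ 2) (fun t => r - t)).
    exact: C1_sqr_pos_part.
  exact: (@C1_addr _ r (fun t => - t) C1_opp).
Qed.

(** These C^1 functions increase to the indicator of the open interval from s to
    r, since q / (1/(n+1) + q) tends to 1 exactly where q is positive. *)
Definition cutoff s r n t : R := bump s r t * (n.+1%:R^-1 + bump s r t)^-1.

Let den_gt0 s r n t : 0 < n.+1%:R^-1 + bump s r t.
Proof. by rewrite ltr_pwDl ?bump_ge0// invr_gt0. Qed.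

Lemma cutoff_ge0 s r n t : 0 <= cutoff s r n t.
Proof. by rewrite mulr_ge0 ?bump_ge0// invr_ge0 ltW. Qed.

Lemma cutoff_le1 s r n t : cutoff s r n t <= 1.
Proof. by rewrite ler_pdivrMr// mul1r lerDr invr_ge0. Qed.

Lemma cutoff_out s r n t : t \notin `]s, r[ -> cutoff s r n t = 0.
Proof. by move=> /bump_out h; rewrite /cutoff h mul0r. Qed.

Lemma C1_cutoff s r n : C1 (cutoff s r n).
Proof.
apply: (@C1M _ (bump s r)); first exact: C1_bump.
apply: C1V; first by move=> t; rewrite gt_eqF.
exact/C1_addr/C1_bump.
Qed.

Lemma cvg_cutoff s r t : t \in `]s, r[ -> cutoff s r n t @[n --> \oo] --> (1 : R).
Proof.
move=> /bump_gt0 b0; rewrite /cutoff.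
rewrite -[X in _ --> X](@mulfV _ (bump s r t)) ?gt_eqF//.
apply: cvgM; first exact: cvg_cst.
apply: cvgV; first by rewrite gt_eqF.
rewrite -[X in _ --> X]add0r; apply: cvgD; last exact: cvg_cst.
exact: cvg_harmonic.
Qed.

End cutoff.

Section fundamental_lemma.
Context {R : realType}.
Variables (a b : R) (f : R -> R).
Let D : set R := `[a, b].
Hypothesis intf : (@mu R).-integrable D (EFin \o f).
Hypothesis f_test : forall phi : R -> R, C1 phi ->
  (exists c d, [/\ a < c, d < b & forall t, t \notin `[c, d] -> phi t = 0]) ->
  \int[mu]_(t in D) (f t * phi t) = 0.

Let mD : measurable D. Proof. exact: measurable_itv. Qed.

(** Test against the cutoffs of the interval: they converge pointwise to its
    indicator and are bounded by 1, so dominated convergence applies. *)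
Lemma integral_sub_itv_eq0 s r : a < s -> r < b ->
  \int[mu]_(t in `]s, r[) f t = 0.
Proof.
move=> as_ rb.
have mf : measurable_fun D f by apply/measurable_EFinP; exact: measurable_int intf.
have phi_test n : exists c d, [/\ a < c, d < b &
    forall t, t \notin `[c, d] -> cutoff s r n t = 0].
  exists s, r; split=> // t tsr; apply: cutoff_out.
  by apply: contra tsr; exact: subset_itv_oo_cc.
pose f_ n t : \bar R := (f t * cutoff s r n t)%:E.
pose f' : R -> \bar R := (EFin \o f) \_ `]s, r[.
have [] := @dominated_convergence _ _ _ mu D mD f_ f' (abse \o (EFin \o f)).
- move=> n; apply/measurable_EFinP; apply: measurable_funM => //.
  apply: measurable_funTS; apply: continuous_measurable_fun.
  exact/C1_continuous/C1_cutoff.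
- apply/measurable_restrict => //.
  by apply: measurable_funS (measurable_int _ intf) => //; exact: subIsetl.
- apply: aeW => t Dt; rewrite /f' patchE; case: ifPn.
    rewrite inE => tsr; rewrite /f_ -[X in _ --> X]/((f t)%:E) -[X in _ --> X%:E]mulr1.
    apply: cvg_EFin; first by near=> n.
    by apply: cvgM; [exact: cvg_cst|exact: cvg_cutoff].
  move=> tsr; have {}tsr : t \notin `]s, r[ by apply: contra tsr; rewrite inE.
  rewrite (_ : f_^~ t = fun=> 0%E); first exact: cvg_cst.
  by apply/funext => n; rewrite /f_ cutoff_out// mulr0.
- exact: integrable_abse.
- apply: aeW => t n Dt; rewrite /f_ /= lee_fin normrM ler_piMr//.
  by rewrite ger0_norm ?cutoff_ge0// cutoff_le1.
move=> if' _ cvgf.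
have iffin : (\int[mu]_(t in D) f' t)%E \is a fin_num by exact: integrable_fin_num.
have : (fun=> 0 : R) @ \oo --> fine (\int[mu]_(t in D) f' t)%E.
  have := cvgf; rewrite -{1}(fineK iffin) => /fine_cvg; apply: cvg_trans.
  rewrite (_ : fine \o _ = (fun=> 0))//; apply/funext => n /=.
  by have /= := f_test (C1_cutoff s r n) (phi_test n).
move=> /cvg_lim; rewrite lim_cst// => /(_ (@Rhausdorff R)) int0.
rewrite [RHS]int0 /Rintegral; congr fine.
rewrite /f' -integral_mkcondr; congr integral; rewrite setIidr//.
apply: subset_itvScc; rewrite bnd_simp; exact: ltW.
Unshelve. all: by end_near. Qed.

(** The primitive of [f], extended by 0, is locally constant inside the interval, as its
    increments are integrals over subintervals, and by Lebesgue differentiation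
    its derivative is almost everywhere [f]. *)
Lemma fundamental_lemma_calculus_variations : {ae @mu R, forall t, D t -> f t = 0}.
Proof.
pose h : R -> R := f \_ D.
have ih : (@mu R).-integrable setT (EFin \o h).
  have := (@integrable_mkcond _ _ _ (@mu R) D (EFin \o f) mD).1 intf.
  by rewrite restrict_EFin.
have ihA (A : set R) : measurable A -> (@mu R).-integrable A (EFin \o h).
  by move=> mA; apply: integrableS ih.
have lh : locally_integrable setT h by exact: open_integrable_locally openT ih.
pose F y := \int[mu]_(t in `]-oo, y]) h t.
have FB x y : a < x -> x <= y -> y < b -> F y = F x.
  move=> ax xy yb; apply/eqP; rewrite -subr_eq0 /F Rintegral_itvB//.
    rewrite -Rintegral_itv_bndo_bndc//; last exact: ihA.
    rewrite -(integral_sub_itv_eq0 ax yb); apply/eqP/eq_Rintegral => t.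
    rewrite inE => txy; rewrite /h patchE ifT// inE.
    by apply: subset_itvScc txy; rewrite bnd_simp ltW.
  by apply: ihA.
have Fae : {ae @mu R, forall x, derivable F x 1 /\ derive1 F x = h x}.
  by apply: FTC1Ny => // y; exact: ihA.
have neae c : {ae @mu R, forall x, x != c}.
  exists [set c]; split => //; first by rewrite lebesgue_measure_set1.
  by move=> x /= /negP; rewrite negbK => /eqP.
have aeF := ae_filter_ringOfSetsType (@mu R).
near=> x => Dx.
have xa : x != a by near: x; exact: neae.
have xb : x != b by near: x; exact: neae.
have [_ Fx] : derivable F x 1 /\ derive1 F x = h x by near: x.
have hx : h x = f x by rewrite /h patchE ifT// inE.
rewrite -hx -Fx derive1E.
move: Dx; rewrite /D/= in_itv/= !le_eqVlt eq_sym (negbTE xa) (negbTE xb)/= => /andP[ax xb'].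
rewrite (@near_eq_derive _ _ _ _ (cst (F x))) ?oner_neq0// ?derive_cst//.
near=> y.
have ay : a < y by near: y; exact: lt_nbhsr.
have yb : y < b by near: y; exact: lt_nbhsl.
by have [xy|/ltW yx] := leP x y; [exact: FB|apply/esym; exact: FB].
Unshelve. all: by end_near. Qed.

End fundamental_lemma.

(** * Weak derivatives on an edge *)

Section edges.
Context {R : realType} {g : metric_graph R}.
Implicit Types (e : edge g) (h dh phi : R -> R) (u w : gpoint g -> R).

Lemma measurable_edge_itv e : measurable (edge_itv e).
Proof. exact: measurable_itv. Qed.

Lemma edge_L2_lin e a b h1 h2 : edge_L2 e h1 -> edge_L2 e h2 ->
  edge_L2 e (fun t => a * h1 t + b * h2 t).
Proof.
move=> L1 L2; rewrite /edge_L2.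
have [L0 Llin] := @Lfun_submod_closed _ _ _ (@mu R) _ (lee1n 2).
have -> : (fun t => a * h1 t + b * h2 t) \_ (edge_itv e) =
    a *: (h1 \_ (edge_itv e)) + (b *: (h2 \_ (edge_itv e)) + 0).
  apply/funext => t; rewrite patchE !fctE !patchE; case: ifPn => _.
    by rewrite addr0.
  by rewrite !scaler0 !addr0.
by apply: (Llin) => //; exact: Llin.
Qed.

Lemma edge_L2_eq e h1 h2 : {in edge_itv e, h1 =1 h2} ->
  edge_L2 e h1 -> edge_L2 e h2.
Proof.
move=> h12; rewrite /edge_L2.
suff -> : h1 \_ (edge_itv e) = h2 \_ (edge_itv e) by [].
by apply/funext => t; rewrite !patchE; case: ifPn => // /h12.
Qed.

Lemma continuous_integrable e h : continuous h ->
  (@mu R).-integrable (edge_itv e) (EFin \o h).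
Proof.
move=> ch; apply: continuous_compact_integrable; first exact: segment_compact.
exact: continuous_subspaceT.
Qed.

Lemma edge_L2_continuous e h : continuous h -> edge_L2 e h.
Proof.
move=> ch; rewrite /edge_L2 inE; apply/andP; split; rewrite inE/=.
  have mh : measurable_fun (edge_itv e) h.
    by apply: measurable_funTS; exact: continuous_measurable_fun.
  exact: (measurable_restrictT h (measurable_edge_itv e)).1 mh.
rewrite /finite_norm unlock poweR_lty//.
have ih2 : (@mu R).-integrable (edge_itv e) (EFin \o (fun t => h t * h t)).
  by apply: continuous_integrable => t; apply: cvgM; exact: ch.
have := (@integrable_mkcond _ _ _ (@mu R) _ _ (measurable_edge_itv e)).1 ih2.
move=> /integrableP[_]; apply: le_lt_trans.
rewrite le_eqVlt; apply/orP; left; apply/eqP/eq_integral => t _.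
rewrite /= !patchE; case: ifPn => _ /=.
  by rewrite powR_mulrn// normrM expr2.
by rewrite normr0 powR0.
Qed.

Lemma edge_L2_integrableM e h1 h2 : edge_L2 e h1 -> edge_L2 e h2 ->
  (@mu R).-integrable (edge_itv e) (EFin \o (fun t => h1 t * h2 t)).
Proof.
move=> L1 L2; have := Lfun2_mul_Lfun1 L1 L2.
move=> /Lfun1_integrable.
set k := (X in integrable _ _ X).
suff -> : k = (EFin \o (fun t => h1 t * h2 t)) \_ (edge_itv e).
  by move/(@integrable_mkcond _ _ _ (@mu R) _ _ (measurable_edge_itv e)).2.
apply/funext => t; rewrite /k /= !patchE; case: ifPn => // _.
by rewrite mulr0.
Qed.

Lemma C1_test_fun e phi : C1 phi -> (exists c d, [/\ 0 < c, d < len e &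
  forall t, t \notin `[c, d] -> phi t = 0]) -> test_fun e phi.
Proof. by move=> [dphi cphi] sphi; split. Qed.

Lemma test_fun_C1 e phi : test_fun e phi -> C1 phi.
Proof. by case. Qed.

Lemma test_fun_L2 e phi : test_fun e phi ->
  edge_L2 e phi /\ edge_L2 e (derive1 phi).
Proof.
move=> [dphi cphi _]; split; apply: edge_L2_continuous => //.
exact/C1_continuous.
Qed.

Lemma Rintegral_lin e a b h1 h2 :
  (@mu R).-integrable (edge_itv e) (EFin \o h1) ->
  (@mu R).-integrable (edge_itv e) (EFin \o h2) ->
  \int[mu]_(t in edge_itv e) (a * h1 t + b * h2 t) =
  a * (\int[mu]_(t in edge_itv e) h1 t) + b * (\int[mu]_(t in edge_itv e) h2 t).
Proof.
move=> i1 i2; have mD := measurable_edge_itv e.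
have iZ c k : (@mu R).-integrable (edge_itv e) (EFin \o k) ->
    (@mu R).-integrable (edge_itv e) (EFin \o (fun t => c * k t)).
  by move=> ik; have := @integrableZl _ _ _ (@mu R) _ mD c _ ik.
rewrite RintegralD//; [|exact: iZ|exact: iZ].
by rewrite !RintegralZl.
Qed.

Lemma weak_deriv_lin e a b h1 h2 dh1 dh2 :
  edge_L2 e h1 -> edge_L2 e h2 -> edge_L2 e dh1 -> edge_L2 e dh2 ->
  weak_deriv e h1 dh1 -> weak_deriv e h2 dh2 ->
  weak_deriv e (fun t => a * h1 t + b * h2 t) (fun t => a * dh1 t + b * dh2 t).
Proof.
move=> L1 L2 dL1 dL2 w1 w2 phi tphi; have [Lp dLp] := test_fun_L2 tphi.
have distr k1 k2 psi : edge_L2 e k1 -> edge_L2 e k2 -> edge_L2 e psi ->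
    \int[mu]_(t in edge_itv e) ((a * k1 t + b * k2 t) * psi t) =
    a * (\int[mu]_(t in edge_itv e) (k1 t * psi t)) +
    b * (\int[mu]_(t in edge_itv e) (k2 t * psi t)).
  move=> Lk1 Lk2 Lpsi; rewrite -Rintegral_lin; [|exact: edge_L2_integrableM..].
  by apply: eq_Rintegral => t _; rewrite mulrDl !mulrA.
by rewrite !distr// w1// w2// !mulrN opprD.
Qed.

Lemma edge_L2_integrable e h : edge_L2 e h ->
  (@mu R).-integrable (edge_itv e) (EFin \o h).
Proof.
move=> Lh; have L1 : edge_L2 e (cst 1) by apply: edge_L2_continuous => t; exact: cvg_cst.
have := edge_L2_integrableM Lh L1; congr integrable.
by apply/funext => t /=; rewrite mulr1.
Qed.

Lemma weak_deriv_unique e h dh1 dh2 : edge_L2 e dh1 -> edge_L2 e dh2 ->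
  weak_deriv e h dh1 -> weak_deriv e h dh2 ->
  {ae @mu R, forall t, edge_itv e t -> dh1 t = dh2 t}.
Proof.
move=> L1 L2 w1 w2; have aeF := ae_filter_ringOfSetsType (@mu R).
have L12 : edge_L2 e (fun t => 1 * dh1 t + (- 1) * dh2 t) by exact: edge_L2_lin.
have : {ae @mu R, forall t, edge_itv e t -> 1 * dh1 t + (- 1) * dh2 t = 0}.
  apply: (@fundamental_lemma_calculus_variations R 0 (len e)); first exact: edge_L2_integrable.
  move=> phi C1phi /(C1_test_fun C1phi) tphi; have [Lphi _] := test_fun_L2 tphi.
  under eq_Rintegral do rewrite mulrDl -!mulrA.
  rewrite Rintegral_lin; [|exact: edge_L2_integrableM..].
  apply/eqP; rewrite mul1r mulN1r subr_eq0 -eqr_opp; apply/eqP.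
  by rewrite -w1// -w2.
by apply: filterS => t + Dt => /(_ Dt)/eqP; rewrite mul1r mulN1r subr_eq0 => /eqP.
Qed.

Lemma nablaP u e : edge_H1 e (restr u e) ->
  edge_L2 e (nabla u e) /\ weak_deriv e (restr u e) (nabla u e).
Proof.
move=> [_ udh].
exact: (@xgetPex _ (cst 0) [set dh | edge_L2 e dh /\ weak_deriv e (restr u e) dh] udh).
Qed.

Lemma edge_H1_lin u w e a b :
  edge_H1 e (restr u e) -> edge_H1 e (restr w e) ->
  edge_H1 e (restr (fun x => a * u x + b * w x) e).
Proof.
move=> [Lu [du [Ldu wu]]] [Lw [dw [Ldw ww]]].
split; first exact: (edge_L2_lin a b Lu Lw).
exists (fun t => a * du t + b * dw t).
by split; [exact: edge_L2_lin|exact: (weak_deriv_lin a b Lu Lw)].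
Qed.

(** Both sides are weak derivatives of the same function. *)
Lemma nabla_lin u w e a b :
  edge_H1 e (restr u e) -> edge_H1 e (restr w e) ->
  {ae @mu R, forall t, edge_itv e t ->
    nabla (fun x => a * u x + b * w x) e t = a * nabla u e t + b * nabla w e t}.
Proof.
move=> Hu Hw.
have [[Lu _] [Lw _]] := (Hu, Hw).
have [[Ldu wu] [Ldw ww]] := (nablaP Hu, nablaP Hw).
have [Ld wd] := nablaP (edge_H1_lin a b Hu Hw).
apply: weak_deriv_unique wd _ => //; first exact: edge_L2_lin.
exact: (weak_deriv_lin a b Lu Lw).
Qed.

End edges.

(** * The energy as a quadratic form and the Green function *)

Section energy.
Context {R : realType} {g : metric_graph R}.
Implicit Types (e : edge g) (u w phi : gpoint g -> R).

Lemma H10_lin u w a b : H10 u -> H10 w -> H10 (fun x => a * u x + b * w x).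
Proof.
move=> [[cu Hu] u0] [[cw Hw] w0]; split; last first.
  by move=> v vend; rewrite u0// w0// !mulr0 addr0.
split; last by move=> e; exact: edge_H1_lin.
move=> x.
have cZ (c : R) (k : gpoint g -> R) :
    {for x, continuous k} -> {for x, continuous (fun y => c * k y)}.
  by move=> ck; apply: (@continuousM _ _ (fun=> c) k x) => //; exact: cst_continuous.
have cD := @continuousD _ _ _ (fun y => a * u y) (fun y => b * w y) x.
exact: cD (cZ _ _ (cu x)) (cZ _ _ (cw x)).
Qed.

Lemma energy_ge0 u : 0 <= energy u.
Proof.
apply: sumr_ge0 => e _; apply: Rintegral_ge0 => t _; exact: sqr_ge0.
Qed.

Lemma dirichletC u w : dirichlet u w = dirichlet w u.
Proof.
by apply: eq_bigr => e _; apply: eq_Rintegral => t _; rewrite mulrC.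
Qed.

Lemma dirichletuu u : dirichlet u u = energy u.
Proof.
apply: eq_bigr => e _; apply: eq_Rintegral => t _.
by rewrite real_normK ?num_real// expr2.
Qed.

Lemma energy_lin u w a b : H1 u -> H1 w ->
  energy (fun x => a * u x + b * w x) =
  a ^+ 2 * energy u + 2 * a * b * dirichlet u w + b ^+ 2 * energy w.
Proof.
move=> [_ Hu] [_ Hw]; rewrite -!dirichletuu /dirichlet /int_graph !mulr_sumr.
rewrite -!big_split/=; apply: eq_bigr => e _.
have mD := measurable_edge_itv e.
have [Lu _] := nablaP (Hu e); have [Lw _] := nablaP (Hw e).
have [L _] := nablaP (edge_H1_lin a b (Hu e) (Hw e)).
have nlin := nabla_lin a b (Hu e) (Hw e).
set n := nabla _ e in L nlin *; set nu := nabla u e in Lu nlin *.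
set nw := nabla w e in Lw nlin *.
have [iuu iuw iww] := And3 (edge_L2_integrableM Lu Lu) (edge_L2_integrableM Lu Lw)
  (edge_L2_integrableM Lw Lw).
transitivity (\int[mu]_(t in edge_itv e)
    ((a * nu t + b * nw t) * (a * nu t + b * nw t))).
  rewrite /Rintegral; congr fine; apply: ae_eq_integral => //.
  - exact: measurable_int (edge_L2_integrableM L L).
  - apply: measurable_int (edge_L2_integrableM _ _); exact: edge_L2_lin.
  - have aeF := ae_filter_ringOfSetsType (@mu R).
    by apply: filterS nlin => t + Dt => /(_ Dt) ->.
transitivity (\int[mu]_(t in edge_itv e)
    (a ^+ 2 * (nu t * nu t) + 1 * (2 * a * b * (nu t * nw t) + b ^+ 2 * (nw t * nw t)))).
  by apply: eq_Rintegral => t _; ring.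
have iZ c k : (@mu R).-integrable (edge_itv e) (EFin \o k) ->
    (@mu R).-integrable (edge_itv e) (EFin \o (fun t => c * k t)).
  by move=> ik; have := @integrableZl _ _ _ (@mu R) _ mD c _ ik.
rewrite Rintegral_lin//; last first.
  exact: (@integrableD _ _ _ (@mu R) _ mD _ _ (iZ _ _ iuw) (iZ _ _ iww)).
by rewrite Rintegral_lin// mul1r addrA.
Qed.

End energy.

(** The discriminant inequality, stated so that [G = 0] is allowed; then the
    polynomial is affine in [c] and can only stay nonnegative if [p = 0]. *)
Lemma sqr_le_mul_of_quad_ge0 {R : realFieldType} (E p G : R) : 0 <= G ->
  (forall c, 0 <= E + 2 * c * p + c ^+ 2 * G) -> p ^+ 2 <= G * E.
Proof.
move=> G_ge0 quad; have [G0|G0] := eqVneq G 0.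
  have [->|p0] := eqVneq p 0; first by rewrite G0 mul0r expr0n.
  (* This c makes the affine polynomial equal to -1. *)
  have := quad (- (E + 1) / (2 * p)).
  rewrite G0 mulr0 addr0 (_ : 2 * _ * p = - (E + 1)); last by field.
  by lra.
have {G_ge0}G0 : 0 < G by rewrite lt_def G0.
(* This c minimizes the quadratic polynomial. *)
have := quad (- p / G).
rewrite (_ : _ + _ + _ = E - p ^+ 2 / G); last by field; rewrite gt_eqF.
by rewrite subr_ge0 ler_pdivrMr// mulrC.
Qed.

Section green.
Context {R : realType} {g : metric_graph R}.
Variable Gr : gpoint g -> gpoint g -> R.
Hypothesis hGr : is_green Gr.
Implicit Types (x y : gpoint g) (u w phi : gpoint g -> R).

Lemma green_cases y :
  (exists2 v, v \in Vend g & y = Vertex v) \/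
  (H10 (Gr^~ y) /\ forall phi, H10 phi -> dirichlet (Gr^~ y) phi = phi y).
Proof.
by have [ve|nve] := pselect (exists2 v, v \in Vend g & y = Vertex v);
  [left|right; exact: (hGr y).2].
Qed.

(** Cauchy-Schwarz for the Dirichlet form of [phi] and [G(., y)], the latter of
    energy [G(y, y)]: it amounts to the nonnegativity of the energy of
    [phi + c G(., y)] for every [c].  At a vertex of degree 1 both sides vanish. *)
Lemma green_ineq y phi : H10 phi -> phi y ^+ 2 <= Gr y y * energy phi.
Proof.
move=> Hphi; have [ve|[HG GP]] := green_cases y.
  rewrite (hGr y).1// mul0r; case: ve => v vend ->.
  by rewrite (Hphi.2 v)// expr0n.
have EG : energy (Gr^~ y) = Gr y y by rewrite -dirichletuu GP.
apply: sqr_le_mul_of_quad_ge0; first by rewrite -EG energy_ge0.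
move=> c; have := energy_ge0 (fun x => 1 * phi x + c * Gr x y).
rewrite (energy_lin 1 c Hphi.1 HG.1) dirichletC GP// EG.
by rewrite expr1n mul1r mulr1.
Qed.

End green.

(** * Points of the graph and the sup norm *)

Section points.
Context {R : realType} {g : metric_graph R}.
Implicit Types (e : edge g) (v : vertex g) (x y : gpoint g) (u : gpoint g -> R).

Lemma chart_src e : chart e 0 = Vertex (src e).
Proof. by rewrite /chart lexx. Qed.

Lemma chart_tgt e : chart e (len e) = Vertex (tgt e).
Proof. by rewrite /chart leNgt len_gt0/= insubF ?ltxx ?andbF. Qed.

Lemma chart_inner e (s : {t : R | 0 < t < len e}) : chart e (val s) = Inner s.
Proof. by rewrite /chart leNgt; have /andP[-> _] := valP s; rewrite valK. Qed.

(** An isolated vertex would be the only vertex by connectedness, but there is a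
    vertex of degree 1. *)
Lemma vertex_incident : (exists v, v \in Vend g) ->
  forall v, exists e, src e = v \/ tgt e = v.
Proof.
move=> [w wend] v; have [->|vw] := eqVneq v w.
  move: wend; rewrite inE => /cards1P[e He].
  have : e \in incident_edges (@src R g) (@tgt R g) w by rewrite He inE.
  by rewrite inE => /orP[/eqP|/eqP] ?; exists e; [left|right].
have /connectP[[|z p] /= pth wE] := @graph_connected R g v w.
  by rewrite wE eqxx in vw.
move: pth => /andP[/existsP[e /orP[/andP[/eqP ? _]|/andP[_ /eqP ?]]] _].
  by exists e; left.
by exists e; right.
Qed.

Lemma chart_surj : (exists v, v \in Vend g) ->
  forall x, exists e t, edge_itv e t /\ chart e t = x.
Proof.
move=> hend [v|e s].
  have [e [ev|ev]] := vertex_incident hend v.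
    by exists e, 0; rewrite chart_src ev /edge_itv/= in_itv/= lexx ltW ?len_gt0.
  by exists e, (len e); rewrite chart_tgt ev /edge_itv/= in_itv/= lexx ltW ?len_gt0.
exists e, (val s); rewrite chart_inner /edge_itv/= in_itv/=; split=> //.
by have /andP[/ltW -> /ltW ->] := valP s.
Qed.

Lemma restr_continuous u e : continuous u -> continuous (restr u e).
Proof.
move=> /continuousP cu; apply/continuousP => A /cu oA.
exact: (oA e).
Qed.

Lemma continuous_of_restr u : (forall e, continuous (restr u e)) -> continuous u.
Proof.
move=> cu; apply/continuousP => A oA.
have : point_open (u @^-1` A) by move=> e; have /continuousP cue := cu e; exact: cue.
exact.
Qed.

(** A continuous function that exceeds [c] at a point does so on an interval of
    positive length, so the essential bound holds pointwise. *)
Lemma edge_norm_le e (h : R -> R) c : continuous h -> 0 <= c ->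
  (('N[@mu R]_+oo [EFin \o (h \_ (edge_itv e))])%E <= c%:E)%E <->
  (forall t, edge_itv e t -> `|h t| <= c).
Proof.
move=> ch c0; rewrite unlock /= ifT; last first.
  rewrite (@lt_le_trans _ _ (mu `[0%R, 1%R]))//.
    by rewrite lebesgue_measure_itv/= lte_fin ltr01 oppr0 adde0 lte_fin.
  by apply: le_measure; rewrite ?inE.
split=> [/ess_supP[N [mN N0 Nc]] t Dt|hc].
- rewrite leNgt; apply/negP => ct.
  have : \forall s \near t, c < `|h s|.
    have cnh : (fun s => `|h s|) @ t --> `|h t| by apply: cvg_norm; exact: ch.
    exact: (cvgr_gt _ cnh).
  move=> /nbhs_ballP[r/= r0 rc].
  move: Dt; rewrite /edge_itv/= in_itv/= => /andP[t0 tl].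
  (* t may be an endpoint of the edge, hence the truncated ball. *)
  have ab : Num.max 0 (t - r) < Num.min (len e) (t + r).
    by rewrite lt_min !gt_max len_gt0; apply/and3P; split; lra.
  pose I : set R := `]Num.max 0 (t - r), Num.min (len e) (t + r)[%classic.
  have : (mu I <= mu N)%E.
    apply: le_measure; rewrite ?inE//; first exact: measurable_itv.
    move=> s.
    rewrite /I/= in_itv/= lt_min gt_max => /andP[/andP[s0 sr] /andP[sl st]].
    apply: Nc => /=; rewrite patchE ifT; last first.
      by rewrite inE /edge_itv/= in_itv/= !ltW.
    rewrite lee_fin; apply/negP; rewrite -ltNge; apply: rc.
    by rewrite /ball/= ltr_norml; apply/andP; split; lra.
  rewrite N0 lebesgue_measure_itv/= lte_fin ab -EFinD lee_fin subr_le0.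
  by rewrite leNgt ab.
- apply/ess_supP; apply: aeW => t; rewrite /= lee_fin patchE.
  by case: ifPn => [/set_mem/hc//|_]; rewrite normr0.
Qed.

Lemma norm_Linfty_le (hend : exists v, v \in Vend g) u c : continuous u -> 0 <= c ->
  (norm_Linfty u <= c%:E)%E <-> (forall x, `|u x| <= c).
Proof.
move=> cu c0; split=> [|uc].
  move=> /bigmax_leP[_ H] x; have [e [t [Dt <-]]] := chart_surj hend x.
  by have /(edge_norm_le _ (restr_continuous cu) c0) := H e isT; apply.
apply/bigmax_leP; split; first by rewrite lee_fin.
move=> e _; apply/(edge_norm_le _ (restr_continuous cu) c0) => t _.
exact: uc.
Qed.

(** The supremum is attained because each of the finitely many edges is compact;
    admissible functions are thus controlled at one point, where the Green
    function can be used. *)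
Lemma norm_Linfty1P (hend : exists v, v \in Vend g) u : continuous u ->
  norm_Linfty u = 1%E <->
  (forall x, `|u x| <= 1) /\ (exists x, `|u x| = 1).
Proof.
move=> cu; split=> [n1|[u1 [y uy]]].
- have u1 : forall x, `|u x| <= 1 by apply/(norm_Linfty_le hend cu) => //; rewrite n1.
  split => //; apply: contrapT => nex.
  have lt1 x : `|u x| < 1.
    by rewrite lt_neqAle u1 andbT; apply/eqP => ux; apply: nex; exists x.
  have /choice[T HT] : forall e, exists t, forall s, edge_itv e s ->
      `|u (chart e s)| <= `|u (chart e t)|.
    move=> e; have cn : {within `[0, len e], continuous (fun t => `|restr u e t|)}.
      apply: continuous_subspaceT => t; apply: cvg_norm; exact: restr_continuous.
    have [t _ tmax] := EVT_max (ltW (len_gt0 e)) cn.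
    by exists t => s; exact: tmax.
  pose c := \big[Num.max/0]_e `|u (chart e (T e))|.
  have c1 : c < 1 by apply/bigmax_ltP; split.
  have : (norm_Linfty u <= c%:E)%E.
    apply/(norm_Linfty_le hend cu); first exact: bigmax_ge_id.
    move=> x; have [e [t [Dt <-]]] := chart_surj hend x.
    by apply: le_trans (HT e t Dt) _; exact: le_bigmax.
  by rewrite n1 lee_fin leNgt c1.
- apply/eqP; rewrite eq_le; apply/andP; split.
    exact/(norm_Linfty_le hend cu).
  have n0 : (0 <= norm_Linfty u)%E by exact: bigmax_ge_id.
  rewrite leNgt; apply/negP => nlt.
  have nfin : norm_Linfty u \is a fin_num by rewrite ge0_fin_numE// (lt_trans nlt) ?ltry.
  have := (norm_Linfty_le hend cu (fine_ge0 n0)).1.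
  rewrite fineK// => /(_ (lexx _) y); rewrite uy leNgt.
  by rewrite -lte_fin fineK// nlt.
Qed.

End points.

(** * A nonzero function in H^1_0 *)

Section positivity.
Context {R : realType} {g : metric_graph R}.
Implicit Types (e : edge g) (x y : gpoint g) (u : gpoint g -> R).

Lemma C1_derivable_oo (f : R -> R) a b : C1 f -> derivable_oo_LRcontinuous f a b.
Proof.
move=> f1; split; first by move=> t _; exact: f1.1.
- exact/cvg_at_right_filter/C1_continuous.
- exact/cvg_at_left_filter/C1_continuous.
Qed.

Lemma C1_weak_deriv e (f : R -> R) : C1 f -> weak_deriv e f (derive1 f).
Proof.
move=> f1 phi tphi; have phi1 := test_fun_C1 tphi.
have [_ _ [c [d [c0 dl phi0]]]] := tphi.
rewrite (@Rintegration_by_parts R f phi (derive1 f) (derive1 phi) 0 (len e))//.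
- rewrite (phi0 (len e)) ?(phi0 0) ?mulr0 ?subrr ?sub0r//.
    by rewrite in_itv/= leNgt c0.
  by rewrite in_itv/= [X in _ && X]leNgt dl andbF.
- exact: len_gt0.
- exact/continuous_subspaceT/f1.2.
- exact: C1_derivable_oo.
- exact/continuous_subspaceT/phi1.2.
- exact: C1_derivable_oo.
Qed.

Lemma C1_edge_H1 e u (f : R -> R) : C1 f ->
  {in edge_itv e, f =1 restr u e} -> edge_H1 e (restr u e).
Proof.
move=> f1 fu; split.
  by apply: edge_L2_eq fu _; apply: edge_L2_continuous; exact: C1_continuous.
exists (derive1 f); split; first exact/edge_L2_continuous/f1.2.
move=> phi tphi; rewrite -(C1_weak_deriv f1 tphi).
by apply: eq_Rintegral => t Dt; rewrite -fu.
Qed.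

Definition edge_parabola e0 (x : gpoint g) : R :=
  if x is Inner e s then
    if e == e0 then val s * (len e - val s) else 0
  else 0.

(** The positive part reflects the clamping of [chart] outside the edge. *)
Lemma restr_edge_parabola e0 e t :
  restr (edge_parabola e0) e t = if e == e0 then Num.max (t * (len e - t)) 0 else 0.
Proof.
rewrite /restr /= /chart; case: leP => t0 /=.
  case: eqP => // _; rewrite max_r//.
  by rewrite mulr_le0_ge0// subr_ge0 (le_trans t0)// ltW// len_gt0.
case: insubP => [s /andP[_ tl] vs|] /=.
  by rewrite vs; case: eqP => // _; rewrite max_l// mulr_ge0 ?subr_ge0 ?ltW.
rewrite t0/= -leNgt => lt; case: eqP => // _; rewrite max_r//.
by rewrite mulr_ge0_le0 ?subr_le0// ltW.
Qed.

Lemma C1_parabola (l : R) : C1 (fun t => t * (l - t)).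
Proof.
apply: (@C1M _ id (fun t => l - t)); first exact: C1_id.
exact: (@C1_addr _ l (fun t => - t) C1_opp).
Qed.

Lemma H10_edge_parabola e0 : H10 (edge_parabola e0).
Proof.
split; last by [].
split.
  apply: continuous_of_restr => e.
  have -> : restr (edge_parabola e0) e =
      (fun t => if e == e0 then Num.max (t * (len e - t)) 0 else 0).
    by apply/funext => t; exact: restr_edge_parabola.
  case: eqP => _ t; last exact: cvg_cst.
  have cp : continuous (fun t : R => t * (len e - t)).
    exact: C1_continuous (C1_parabola (len e)).
  exact: (continuous_max (cp t) (@cst_continuous R R 0 t)).
move=> e; have [->|ne] := eqVneq e e0.
  apply: C1_edge_H1 (C1_parabola (len e0)) _ => t.
  rewrite inE /edge_itv/= in_itv/= => /andP[t0 tl].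
  by rewrite restr_edge_parabola eqxx max_l// mulr_ge0// subr_ge0.
apply: (@C1_edge_H1 _ _ (cst 0)).
  by apply: (@C1_is_derive _ _ (cst 0)) => t; exact: cvg_cst.
by move=> t _; rewrite restr_edge_parabola (negbTE ne).
Qed.

Lemma H10_neq0 : (exists v, v \in Vend g) ->
  exists2 u, H10 u & exists x : gpoint g, u x != 0.
Proof.
move=> hend; have [w _] := hend; have [e _] := vertex_incident hend w.
exists (edge_parabola e); first exact: H10_edge_parabola.
have l0 := len_gt0 e.
exists (chart e (len e / 2)); have := restr_edge_parabola e e (len e / 2).
rewrite /restr/= eqxx => ->; rewrite gt_eqF// lt_max mulr_gt0//; lra.
Qed.

End positivity.

(** * Minimizers *)

Section minimizers.
Context {R : realType} {g : metric_graph R}.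
Variable Gr : gpoint g -> gpoint g -> R.
Hypothesis hGr : is_green Gr.
Hypothesis hend : exists v, v \in Vend g.
Implicit Types (a b x : gpoint g) (u : gpoint g -> R).

(** If [u(x) <> 0] with [u] in [H^1_0], then [green_ineq] at [x] excludes
    [G(x, x) <= 0]. *)
Lemma argmax_green_gt0 a : argmax_green Gr a -> 0 < Gr a a.
Proof.
move=> ha; have [u Hu [x ux]] := H10_neq0 hend.
have xx0 : 0 < Gr x x * energy u.
  by apply: lt_le_trans (green_ineq hGr x Hu); rewrite lt_def sqr_ge0 sqrf_eq0 ux.
apply: lt_le_trans (ha x); rewrite ltNge; apply/negP => Gx0.
by move: xx0; rewrite ltNge mulr_le0_ge0// energy_ge0.
Qed.

Lemma H10_green a : argmax_green Gr a -> H10 (Gr^~ a) /\ energy (Gr^~ a) = Gr a a.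
Proof.
move=> /argmax_green_gt0 Ga0; have [ve|[HG GP]] := green_cases hGr a.
  by move: Ga0; rewrite (hGr a).1// ltxx.
by split=> //; rewrite -dirichletuu GP.
Qed.

Lemma dirichlet_green a u : argmax_green Gr a -> H10 u -> dirichlet (Gr^~ a) u = u a.
Proof.
move=> /argmax_green_gt0 Ga0 Hu; have [ve|[HG ->//]] := green_cases hGr a.
by move: Ga0; rewrite (hGr a).1// ltxx.
Qed.

(** [green_ineq] for [phi = G(., a)] reads [G(x, a)^2 <= G(x, x) * G(a, a)]. *)
Lemma green_le a x : argmax_green Gr a -> `|Gr x a| <= Gr a a.
Proof.
move=> ha; have Ga0 := argmax_green_gt0 ha; have [HG EG] := H10_green ha.
rewrite -(@ler_pXn2r _ 2)// ?nnegrE ?(ltW Ga0)// real_normK ?num_real//.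
have := green_ineq hGr x HG; rewrite EG => /le_trans; apply.
by rewrite expr2 ler_wpM2r// ltW.
Qed.

Lemma admissible_green_normalized a : argmax_green Gr a ->
  admissible (green_normalized Gr a) /\
  energy (green_normalized Gr a) = (Gr a a)^-1.
Proof.
move=> ha; have Ga0 := argmax_green_gt0 ha; have [HG EG] := H10_green ha.
have wE : green_normalized Gr a = fun x => 0 * Gr x a + (Gr a a)^-1 * Gr x a.
  by apply/funext => x; rewrite mul0r add0r mulrC.
have Hw : H10 (green_normalized Gr a) by rewrite wE; exact: H10_lin.
split; last first.
  rewrite wE (energy_lin _ _ HG.1 HG.1) EG expr0n/= !mulr0 !mul0r !add0r.
  by rewrite expr2 -mulrA mulVf ?mulr1// gt_eqF.
split => //; apply/(norm_Linfty1P hend Hw.1.1); split.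
  move=> x; rewrite normrM normfV (gtr0_norm Ga0) ler_pdivrMr// mul1r.
  exact: green_le.
by exists a; rewrite /green_normalized mulfV ?normr1// gt_eqF.
Qed.

Lemma energy_admissible_ge u x : H10 u -> `|u x| = 1 -> 1 <= Gr x x * energy u.
Proof.
move=> Hu ux; apply: le_trans (green_ineq hGr x Hu).
by rewrite -real_normK ?num_real// ux expr1n.
Qed.

Lemma S_infty_green a : argmax_green Gr a -> S_infty g = (Gr a a)^-1.
Proof.
move=> ha; have Ga0 := argmax_green_gt0 ha.
have [wad Ew] := admissible_green_normalized ha.
have lb : lbound [set energy u | u in @admissible R g] (Gr a a)^-1.
  move=> _ [u [Hu /(norm_Linfty1P hend Hu.1.1)[_ [x ux]]] <-].
  rewrite -[_^-1]mul1r ler_pdivrMr// mulrC.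
  apply: le_trans (energy_admissible_ge Hu ux) _.
  by rewrite ler_wpM2r// energy_ge0.
apply/eqP; rewrite eq_le; apply/andP; split.
  rewrite -Ew; apply: ge_inf; first by exists (Gr a a)^-1.
  by exists (green_normalized Gr a).
apply: lb_le_inf => //.
by exists (energy (green_normalized Gr a)); exists (green_normalized Gr a).
Qed.

(** Equality in the lower bound puts the maximum point [b] of [u] in [M] and makes
    the energy of [u - w_b] vanish; [green_ineq] then bounds [u - w_b] by 0. *)
Lemma minimizer_green_normalized a u : argmax_green Gr a ->
  (forall x, 0 <= u x) -> minimizer u ->
  exists2 b, argmax_green Gr b & u = green_normalized Gr b.
Proof.
move=> ha u0 [[Hu /(norm_Linfty1P hend Hu.1.1)[_ [b ub]]] Eu].
have Ga0 := argmax_green_gt0 ha; rewrite (S_infty_green ha) in Eu.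
have hb : argmax_green Gr b.
  move=> x; apply: le_trans (ha x) _.
  by have := energy_admissible_ge Hu ub; rewrite Eu ler_pdivlMr// mul1r.
have Gb0 := argmax_green_gt0 hb; have [HG EG] := H10_green hb.
have {}Eu : energy u = (Gr b b)^-1.
  by rewrite -(S_infty_green hb) (S_infty_green ha).
exists b => //; apply/funext => x; apply/eqP; rewrite -subr_eq0.
pose d x := 1 * u x + - (Gr b b)^-1 * Gr x b.
have Ed : energy d = 0.
  rewrite (energy_lin _ _ Hu.1 HG.1) dirichletC dirichlet_green// Eu EG.
  rewrite -(ger0_norm (u0 b)) ub; field; exact: lt0r_neq0.
have := green_ineq hGr x (H10_lin 1 (- (Gr b b)^-1) Hu HG).
rewrite [energy _]Ed mulr0 => dx; rewrite -sqrf_eq0 eq_le sqr_ge0 andbT.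
by move: dx; rewrite mul1r mulNr mulrC.
Qed.

End minimizers.

Theorem proposition7 (R : realType) (g : metric_graph R)
    (hend : exists v, v \in Vend g)
    (Gr : gpoint g -> gpoint g -> R) (hGr : is_green Gr)
    (a : gpoint g) (ha : argmax_green Gr a) :
  [/\ S_infty g = (Gr a a)^-1,
      minimizer (green_normalized Gr a) &
      forall u : gpoint g -> R, (forall x, 0 <= u x) -> minimizer u ->
        exists2 b, argmax_green Gr b & u = green_normalized Gr b].
Proof.
have SE := S_infty_green hGr hend ha; split=> //.
  have [wad Ew] := admissible_green_normalized hGr hend ha.
  by split=> //; rewrite SE.
by move=> u; exact: (minimizer_green_normalized hGr hend ha).
Qed.
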